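(* Let $\mathsf{K}$ be any variety of positive Sugihara monoids. Then every $\mathsf{K}$-epimorphism is surjective; i.e., all axiomatic extensions of the negation-less fragment of the relevance logic $\mathbf{RM}^{\mathbf{t}}$ have the infinite Beth property.
   Context: A commutative residuated lattice (CRL) is an algebra $\langle A;\cdot,\to,\wedge,\vee,e\rangle$ such that $\langle A;\wedge,\vee\rangle$ is a lattice, $\langle A;\cdot,e\rangle$ is a commutative monoid, and $x\cdot y\leqslant z\iff x\leqslant y\to z$, where $\leqslant$ is the lattice order. It is idempotent if $a\cdot a=a$ for all $a$, and distributive if its lattice reduct is distributive. An involution on a CRL is a unary operation $\sim$ with $\sim\sim a=a$ and $a\to\sim b=b\to\sim a$ for all $a,b$; an involutive CRL is the expansion of a CRL by an involution. A Sugihara monoid is an idempotent distributive involutive CRL. A positive Sugihara monoid is a CRL that can be embedded into the CRL-reduct of some Sugihara monoid; the class $\mathsf{PSM}$ of all positive Sugihara monoids is known to be a variety. A class $\mathsf{K}$ of similar algebras is regarded as a category whose morphisms are all algebraic homomorphisms between members of $\mathsf{K}$. A $\mathsf{K}$-morphism $h\colon A\to B$ is a $\mathsf{K}$-epimorphism if, for all $\mathsf{K}$-morphisms $f,g$ from $B$ to a single member of $\mathsf{K}$, $f\circ h=g\circ h$ implies $f=g$. The negation-less fragment of $\mathbf{RM}^{\mathbf{t}}$ (R-mingle with the Ackermann constant, of Anderson and Belnap) is the logic in the signature $\cdot,\to,\wedge,\vee,e$ algebraized by $\mathsf{PSM}$: $\Gamma\vdash\alpha$ iff there is a finite $\Gamma'\subseteq\Gamma$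 such that, in every positive Sugihara monoid, every valuation giving each member of $\Gamma'$ a value $\geqslant e$ gives $\alpha$ a value $\geqslant e$. Its axiomatic extensions are the logics similarly determined by the subvarieties of $\mathsf{PSM}$. Write $\alpha\leftrightarrow\beta$ for $(\alpha\to\beta)\wedge(\beta\to\alpha)$. The infinite Beth property for a logic $\vdash$ says the following. Let $X$ and $Z$ be disjoint sets of variables (of arbitrary, possibly infinite cardinality, arbitrarily many variables being available) and $\Gamma$ a (possibly infinite) set of formulas over $X\cup Z$. Suppose that $\Gamma\cup\sigma[\Gamma]\vdash z\leftrightarrow\sigma(z)$ for all $z\in Z$ and all uniform substitutions $\sigma$ (of formulas for variables) such that $\sigma(x)=x$ for all $x\in X$, where the formulas in the range of $\sigma|_{X\cup Z}$ may involve arbitrarily many variables beyond $X\cup Z$. Then for each $z\in Z$ there is a formula $\varphi_z$ over $X$ only such that $\Gamma\vdash z\leftrightarrow\varphi_z$. (It is assumed that $X\neq\emptyset$ unless the signature has constant symbols.) For an algebraizable logic, the infinite Beth property is known to be equivalent to surjectivity of all epimorphisms in the algebraic counterpart. *)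

(* Defs.v *)
From mathcomp Require Import all_boot.
From mathcomp Require Import classical_sets cardinality.

Set Implicit Arguments.
Unset Strict Implicit.
Unset Printing Implicit Defensive.

Local Open Scope classical_set_scope.

(* Carriers are arbitrary types: MathComp's [latticeType] would force a choice
   structure and a boolean order on every algebra. *)
Record algebra := Algebra {
  carrier :> Type;
  mul : carrier -> carrier -> carrier;
  imp : carrier -> carrier -> carrier;
  meet : carrier -> carrier -> carrier;
  join : carrier -> carrier -> carrier;
  one : carrier
}.
Arguments one {a}.

Definition le (A : algebra) (x y : A) : Prop := meet x y = x.

Record is_lattice (A : algebra) : Prop := IsLattice {
  meetC : commutative (@meet A);
  joinC : commutative (@join A);
  meetA : associative (@meet A);
  joinA : associative (@join A);
  meetK : forall x y : A, meet x (join x y) = x;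
  joinK : forall x y : A, join x (meet x y) = x
}.

Record is_CRL (A : algebra) : Prop := IsCRL {
  CRL_lattice : is_lattice A;
  mulA : associative (@mul A);
  mulC : commutative (@mul A);
  mul1 : left_id one (@mul A);
  residuation : forall x y z : A, le (mul x y) z <-> le x (imp y z)
}.

Definition is_idempotent (A : algebra) : Prop := forall a : A, mul a a = a.

Definition is_distributive (A : algebra) : Prop :=
  right_distributive (@meet A) (@join A).

Definition is_involution (A : algebra) (neg : A -> A) : Prop :=
  involutive neg /\ forall a b : A, imp a (neg b) = imp b (neg a).

Record is_sugihara_monoid (A : algebra) (neg : A -> A) : Prop :=
  IsSugiharaMonoid {
    sugihara_CRL : is_CRL A;
    sugihara_idempotent : is_idempotent A;
    sugihara_distributive : is_distributive A;
    sugihara_involution : is_involution neg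
  }.

Record is_hom (A B : algebra) (h : A -> B) : Prop := IsHom {
  hom_mul : forall x y : A, h (mul x y) = mul (h x) (h y);
  hom_imp : forall x y : A, h (imp x y) = imp (h x) (h y);
  hom_meet : forall x y : A, h (meet x y) = meet (h x) (h y);
  hom_join : forall x y : A, h (join x y) = join (h x) (h y);
  hom_one : h one = one
}.

Definition positive_sugihara_monoid (A : algebra) : Prop :=
  is_CRL A /\
  exists (S : algebra) (neg : S -> S) (h : A -> S),
    [/\ is_sugihara_monoid neg, is_hom h & injective h].

Inductive term (V : Type) : Type :=
| Var of V
| Mul of term V & term V
| Imp of term V & term V
| Meet of term V & term V
| Join of term V & term V
| One.
Arguments One {V}.

Fixpoint eval (V : Type) (A : algebra) (v : V -> A) (t : term V) : A :=
  match t with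
  | Var x => v x
  | Mul s t => mul (eval v s) (eval v t)
  | Imp s t => imp (eval v s) (eval v t)
  | Meet s t => meet (eval v s) (eval v t)
  | Join s t => join (eval v s) (eval v t)
  | One => one
  end.

Fixpoint subst (V W : Type) (sigma : V -> term W) (t : term V) : term W :=
  match t with
  | Var x => sigma x
  | Mul s t => Mul (subst sigma s) (subst sigma t)
  | Imp s t => Imp (subst sigma s) (subst sigma t)
  | Meet s t => Meet (subst sigma s) (subst sigma t)
  | Join s t => Join (subst sigma s) (subst sigma t)
  | One => One
  end.

Definition rename (V W : Type) (r : V -> W) : term V -> term W :=
  subst (fun x => Var (r x)).

Definition equiv_term (V : Type) (s t : term V) : term V :=
  Meet (Imp s t) (Imp t s).

(* Classes of algebras are written [algebra -> Prop] rather than [set algebra],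
   so that the universe of carriers is not bounded by that of [set]. *)
Definition is_variety (K : algebra -> Prop) : Prop :=
  exists E : set (term nat * term nat), forall A : algebra,
    K A <-> forall s t, E (s, t) -> forall v : nat -> A, eval v s = eval v t.

Definition is_epimorphism (K : algebra -> Prop) (A B : algebra) (h : A -> B) :
    Prop :=
  forall (C : algebra) (f g : B -> C), K C -> is_hom f -> is_hom g ->
    (forall a, f (h a) = g (h a)) -> forall b, f b = g b.

Definition epimorphisms_surjective (K : algebra -> Prop) : Prop :=
  forall (A B : algebra) (h : A -> B), K A -> K B -> is_hom h ->
    is_epimorphism K h -> forall b : B, exists a : A, h a = b.

(* Any type may serve as the set of variables. *)
Definition logic := forall V : Type, set (term V) -> term V -> Prop.

Definition logic_of (K : algebra -> Prop) : logic := fun V Gamma alpha =>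
  exists Gamma' : set (term V),
    [/\ finite_set Gamma', Gamma' `<=` Gamma
      & forall (A : algebra) (v : V -> A), K A ->
          (forall gamma, Gamma' gamma -> le one (eval v gamma)) ->
          le one (eval v alpha)].

(* Disjointness of X and Z is built into the sum type, and W supplies the
   further variables that may occur in the range of sigma; only the values of
   sigma on X + Z matter. The proviso that X be nonempty is void here, since
   the signature has the constant [One]. *)
Definition infinite_Beth_property (L : logic) : Prop :=
  forall (X Z : Type) (Gamma : set (term (X + Z))),
    (forall (W : Type) (sigma : X + Z -> term (X + Z + W)),
       (forall x : X, sigma (inl x) = Var (inl (inl x))) ->
       forall z : Z,
         L _ (rename inl @` Gamma `|` subst sigma @` Gamma)
           (equiv_term (Var (inl (inr z))) (sigma (inr z)))) ->
    forall z : Z, exists phi : term X,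
      L _ Gamma (equiv_term (Var (inr z)) (rename inl phi)).

(* Main.v *)
From mathcomp Require Import all_boot boolp classical_sets cardinality.
Require Import Defs.

(** Both halves of the theorem come from one fact: if [K] is a variety of
positive Sugihara monoids, [B] is in [K] and the image [H] of a homomorphism
[h : A -> B] is not all of [B], then two distinct homomorphisms from [B] into a
quotient of [B] agree on [H].

The relevant quotients of [B] are given by its filters: the lattice filters
containing [1], with [x] and [y] identified when [x ==> y] and [y ==> x] lie in
the filter. Prelinearity makes the quotient by a prime filter a chain. Assume
that [h] is an epimorphism. The proof has three steps.

Every prime quotient is covered ([onto_prime_quotient]): each element of [B]
is equivalent modulo a prime filter to an element of [H]. In the picture of a
chain as a set of integers, where the product keeps the factor of larger
absolute value, suppose that the positive element [p] is missed by [H]. Collapse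
to [1] everything of absolute value below [p], or everything of absolute value
at most [p]. The second quotient embeds in the first, so both are maps
into the first; they differ at [p] and agree at all elements of other absolute
value. Here [collapse] is the map from the first quotient onto a copy of the
second inside it.

Filters are compared by their traces on [H] ([prime_filter_trace_le]): if [G]
is prime and the trace of a filter [F] is contained in that of [G], then [F] is
contained in [G]. The filter [F'] generated by [F] and the trace of [G] has the
same trace as [G]. By the first step [B] modulo [G] is [H] modulo that trace,
which maps into [B] modulo [F'], so [B] has two homomorphisms into its quotient
by [F'] that agree on [H]. They must coincide, which forces [F'] to lie in [G].

Local information is glued ([epimorphism_surjective]). Fix [b] in [B]. The
elements [c <= 1] of [H] with [c * b] in [H] are closed under join, because
multiplication distributes over joins; if [1] is one of them then [b] is in [H].
Otherwise some prime filter [F] avoids them all. By the first step [F] contains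
[w], the equivalence of [b] with some [h a], cut down to [w <= 1]. No element of
the trace of [F] can be below [w], since [c <= w] gives [c * b = c * h a]. So a
prime filter extends the trace of [F] and omits [w], against the second step.

For the infinite Beth property let [B] be the algebra of formulas over [X + Z]
modulo equivalence under [Gamma], and map the formulas over [X] to it. Two
homomorphisms [f] and [g] from [B] to [C] that agree on [X] amount to a
valuation of [Gamma] and of a substitution instance of [Gamma], once the
elements of [C] themselves are used as the further variables; implicit
definability then says that [f] and [g] agree on [Z]. So the map is an
epimorphism, hence surjective, and a preimage of the class of [z] is an explicit
definition of [z]. The surjectivity lemma is stated for an arbitrary source
algebra so that it applies to the absolutely free algebra of formulas. *)

Set Implicit Arguments.
Unset Strict Implicit.
Unset Printing Implicit Defensive.

Declare Scope alg_scope.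
Local Infix "<=" := le : alg_scope.
Local Infix "*" := mul : alg_scope.
Local Infix "==>" := imp : alg_scope.
Local Infix "`&`" := meet : alg_scope.
Local Infix "`|`" := join : alg_scope.
Local Notation "1" := one : alg_scope.
Local Open Scope alg_scope.

(** * Commutative residuated lattices *)

Section ResiduatedLattices.
Variables (A : algebra) (cA : is_CRL A).
Implicit Types x y z w : A.

Let lA := CRL_lattice cA.

Lemma le_refl x : x <= x.
Proof. by rewrite /le; have := meetK lA x (x `&` x); rewrite (joinK lA). Qed.

Lemma le_trans y x z : x <= y -> y <= z -> x <= z.
Proof. by move=> xy yz; rewrite /le -xy -(meetA lA) yz. Qed.

Lemma le_anti x y : x <= y -> y <= x -> x = y.
Proof. by move=> xy yx; rewrite -[LHS]xy (meetC lA). Qed.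

Lemma meet_lel x y : x `&` y <= x.
Proof. by rewrite /le (meetC lA) (meetA lA) (le_refl x). Qed.

Lemma meet_ler x y : x `&` y <= y.
Proof. by rewrite (meetC lA); exact: meet_lel. Qed.

Lemma le_meet z x y : z <= x -> z <= y -> z <= x `&` y.
Proof. by move=> zx zy; rewrite /le (meetA lA) zx. Qed.

Lemma le_joinl x y : x <= x `|` y.
Proof. exact: (meetK lA). Qed.

Lemma le_joinr x y : y <= x `|` y.
Proof. by rewrite (joinC lA); exact: le_joinl. Qed.

Lemma joinE x y : x <= y -> x `|` y = y.
Proof. by move=> xy; rewrite -[in LHS]xy (joinC lA) (meetC lA) (joinK lA). Qed.

Lemma join_le z x y : x <= z -> y <= z -> x `|` y <= z.
Proof.
by move=> xz yz; rewrite -(joinE xz) -(joinE yz) (joinA lA); exact: le_joinl.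
Qed.

Lemma mulr1 x : x * 1 = x.
Proof. by rewrite (mulC cA) (mul1 cA). Qed.

Lemma imp_elim x y : x * (x ==> y) <= y.
Proof. by rewrite (mulC cA); apply/(residuation cA); exact: le_refl. Qed.

Lemma imp_intro x y z : x * z <= y -> z <= x ==> y.
Proof. by move=> xzy; apply/(residuation cA); rewrite (mulC cA). Qed.

Lemma mul_mono x x' y y' : x <= x' -> y <= y' -> x * y <= x' * y'.
Proof.
have right_mono z u v : u <= v -> z * u <= z * v.
  move=> uv; rewrite (mulC cA); apply/(residuation cA).
  by apply: le_trans uv _; apply: imp_intro; exact: le_refl.
move=> xx' yy'; apply: (@le_trans (x * y')); first exact: right_mono.
by rewrite ![_ * y'](mulC cA); exact: right_mono.
Qed.

Lemma imp1l x : 1 ==> x = x.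
Proof.
apply: le_anti; first by rewrite -[X in X <= _](mul1 cA); exact: imp_elim.
by apply: imp_intro; rewrite (mul1 cA); exact: le_refl.
Qed.

Lemma le_imp1 x y : 1 <= x ==> y <-> x <= y.
Proof. by rewrite -(residuation cA) (mul1 cA). Qed.

(** Multiplication by [z] has a right adjoint, so it preserves joins. *)
Lemma mul_joinl x y z : (x `|` y) * z = x * z `|` y * z.
Proof.
apply: le_anti; last first.
  by apply: join_le; apply: mul_mono; rewrite ?le_refl //;
    [exact: le_joinl | exact: le_refl | exact: le_joinr | exact: le_refl].
apply/(residuation cA).
by apply: join_le; apply/(residuation cA); [exact: le_joinl | exact: le_joinr].
Qed.

Lemma equiv_le1 (V : Type) (v : V -> A) (s t : term V) :
  1 <= eval v (equiv_term s t) <-> eval v s = eval v t.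
Proof.
split=> [st | /= ->].
  apply: le_anti; apply/le_imp1; apply: le_trans st _;
    [exact: meet_lel | exact: meet_ler].
by apply: le_meet; apply/le_imp1; exact: le_refl.
Qed.

Lemma mul_impl x y z : x * ((x ==> y) `&` z) <= y.
Proof.
apply: le_trans (imp_elim x y).
by apply: mul_mono; [exact: le_refl | exact: meet_lel].
Qed.

Lemma mul_impr x y z : x * (z `&` (x ==> y)) <= y.
Proof. by rewrite (meetC lA); exact: mul_impl. Qed.

Lemma mul_meet1 x z : x * (z `&` 1) <= x.
Proof.
rewrite -[X in le _ X]mulr1.
by apply: mul_mono; [exact: le_refl | exact: meet_ler].
Qed.

End ResiduatedLattices.

(** * Homomorphisms, quotients and term algebras *)

Lemma hom_le (A B : algebra) (h : A -> B) x y :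
  is_hom h -> x <= y -> h x <= h y.
Proof. by move=> hh xy; rewrite /le -(hom_meet hh) xy. Qed.

Lemma hom_comp (A B C : algebra) (f : A -> B) (g : B -> C) :
  is_hom f -> is_hom g -> is_hom (g \o f).
Proof.
move=> hf hg; split=> [x y|x y|x y|x y|] /=.
- by rewrite (hom_mul hf) (hom_mul hg).
- by rewrite (hom_imp hf) (hom_imp hg).
- by rewrite (hom_meet hf) (hom_meet hg).
- by rewrite (hom_join hf) (hom_join hg).
- by rewrite (hom_one hf) (hom_one hg).
Qed.

Lemma hom_eval (V : Type) (A B : algebra) (h : A -> B) (v : V -> A) t :
  is_hom h -> h (eval v t) = eval (h \o v) t.
Proof.
move=> hh; elim: t => //= [s IHs t IHt|s IHs t IHt|s IHs t IHt|s IHs t IHt|].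
- by rewrite (hom_mul hh) IHs IHt.
- by rewrite (hom_imp hh) IHs IHt.
- by rewrite (hom_meet hh) IHs IHt.
- by rewrite (hom_join hh) IHs IHt.
- exact: hom_one hh.
Qed.

Lemma eval_subst (V W : Type) (A : algebra) (v : W -> A)
    (sigma : V -> term W) t :
  eval v (subst sigma t) = eval (fun x => eval v (sigma x)) t.
Proof. by elim: t => //= s -> t ->. Qed.

Definition term_algebra (V : Type) : algebra :=
  Algebra (@Mul V) (@Imp V) (@Meet V) (@Join V) One.

Lemma eval_term_algebra (V W : Type) (sigma : V -> term W) t :
  eval (sigma : V -> term_algebra W) t = subst sigma t.
Proof. by elim: t => //= s -> t ->. Qed.

Lemma subst_Var (V : Type) (t : term V) : subst (@Var V) t = t.
Proof. by elim: t => //= s -> t ->. Qed.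

Lemma hom_term_algebra (V : Type) (C : algebra) (k : term_algebra V -> C) t :
  is_hom k -> k t = eval (k \o @Var V) t.
Proof.
move=> hk; rewrite -(hom_eval (@Var V : V -> term_algebra V) t hk).
by rewrite eval_term_algebra subst_Var.
Qed.

Record is_congruence (A : algebra) (R : A -> A -> Prop) : Prop :=
  IsCongruence {
    cong_refl : forall x, R x x;
    cong_sym : forall x y, R x y -> R y x;
    cong_trans : forall y x z, R x y -> R y z -> R x z;
    cong_mul : forall x x' y y', R x x' -> R y y' -> R (x * y) (x' * y');
    cong_imp : forall x x' y y', R x x' -> R y y' -> R (x ==> y) (x' ==> y');
    cong_meet : forall x x' y y', R x x' -> R y y' -> R (x `&` y) (x' `&` y');
    cong_join : forall x x' y y', R x x' -> R y y' -> R (x `|` y) (x' `|` y')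
  }.

(** The carrier is the set of classes, as predicates, so that equality of
classes is equality; the operations act on chosen representatives. *)
Lemma quotient_algebra (A : algebra) (R : A -> A -> Prop) :
  is_congruence R ->
  exists (Q : algebra) (pi : A -> Q),
    [/\ is_hom pi, forall q, exists x, pi x = q
      & forall x y, pi x = pi y <-> R x y].
Proof.
move=> cR; pose Q := {S : A -> Prop | exists x, S = R x}.
pose pi x : Q := exist _ (R x) (ex_intro _ x erefl).
have sval_inj (p q : Q) : sval p = sval q -> p = q.
  case: p q => [S hS] [T hT] /= ST; case: T / ST hT => hT.
  by congr exist; exact: Prop_irrelevance.
pose repr (q : Q) := sval (cid (svalP q)).
have piE x y : pi x = pi y <-> R x y.
  split=> [/(congr1 sval) /= xy | xy].
    by rewrite xy; exact: cong_refl.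
  apply: sval_inj; apply/funext => z; apply/propext; split.
  - exact: cong_trans (cong_sym cR xy).
  - exact: cong_trans xy.
have reprK q : pi (repr q) = q.
  by apply: sval_inj; rewrite /repr; case: cid => x /= ->.
have reprR x : R (repr (pi x)) x by apply/piE; rewrite reprK.
pose lift2 op (p q : Q) := pi (op (repr p) (repr q)).
exists (Algebra (lift2 (@mul A)) (lift2 (@imp A)) (lift2 (@meet A))
  (lift2 (@join A)) (pi 1)), pi.
split=> //; last by move=> q; exists (repr q).
split=> // x y; apply/piE.
- by apply: cong_mul => //; apply: cong_sym.
- by apply: cong_imp => //; apply: cong_sym.
- by apply: cong_meet => //; apply: cong_sym.
- by apply: cong_join => //; apply: cong_sym.
Qed.

Lemma variety_quotient (K : algebra -> Prop) (A Q : algebra) (pi : A -> Q) :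
  is_variety K -> K A -> is_hom pi -> (forall q, exists x, pi x = q) -> K Q.
Proof.
case=> E KE /KE KA hpi /choice[r rK]; apply/KE => s t st v.
have -> : v = pi \o (r \o v) by apply/funext => n /=; rewrite rK.
by rewrite -!(hom_eval _ _ hpi) (KA _ _ st).
Qed.

(** * The laws of positive Sugihara monoids that matter *)

(** These are inherited by subalgebras and mention no involution, so that they
hold in every quotient that stays in the variety. [psm_reflection] is what
survives of the involution: in a chain it says that [u < 1] implies
[(x ==> 1) ==> u <= x], so that [x ==> 1] still determines [x] among the
elements below such a [u]. *)
Record psm_laws (A : algebra) : Prop := PsmLaws {
  psm_CRL : is_CRL A;
  psm_idempotent : is_idempotent A;
  psm_distributive : is_distributive A;
  psm_prelinear : forall x y : A, 1 <= (x ==> y) `|` (y ==> x);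
  psm_reflection : forall x u : A, 1 <= (((x ==> 1) ==> u) ==> x) `|` u
}.

Section SugiharaMonoids.
Variables (S : algebra) (neg : S -> S) (sS : is_sugihara_monoid neg).
Implicit Types x y u : S.

Let cS := sugihara_CRL sS.
Let idS := sugihara_idempotent sS.
Let leT := le_trans cS.
Let leR := le_refl cS.

Let negK x : neg (neg x) = x.
Proof. exact: (proj1 (sugihara_involution sS)). Qed.

Let le_neg x y : x <= neg y <-> x * y <= neg 1.
Proof.
have negE z : neg z = z ==> neg 1.
  by rewrite (proj2 (sugihara_involution sS)) (imp1l cS).
by rewrite [neg y]negE -(residuation cS).
Qed.

Let mul_neg x : x * neg x <= neg 1.
Proof. by rewrite (mulC cS); apply: (proj1 (le_neg _ _)); exact: leR. Qed.

(* By idempotence: [neg 1 * neg 1 = neg 1]. *)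
Let neg1_le1 : neg 1 <= 1.
Proof.
have: neg 1 <= neg (neg 1) by apply/le_neg; rewrite idS; exact: leR.
by rewrite negK.
Qed.

Let le1_join x y : neg (x `|` y) <= neg 1 -> 1 <= x `|` y.
Proof.
by rewrite -{2}(negK (x `|` y)) => ?; apply/le_neg; rewrite (mul1 cS).
Qed.

Let neg_anti x y : x <= y -> neg y <= neg x.
Proof.
move=> xy; apply/le_neg; rewrite (mulC cS).
by apply: leT (mul_neg y); apply: mul_mono.
Qed.

Let neg_imp x y : neg (x ==> y) <= x * neg y.
Proof.
rewrite -(negK (x * neg y)); apply: neg_anti; apply: (imp_intro cS).
rewrite -[in X in _ <= X](negK y); apply/le_neg.
by rewrite -(mulA cS) (mulC cS (neg _)) (mulA cS); exact: mul_neg.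
Qed.

(** If [j] is the join, it suffices that [neg j <= neg 1]. Now [neg j] lies below
both [x * neg y] and [y * neg x], hence, being idempotent, below their product;
regrouped as [(x * neg x) * (y * neg y)], this is at most
[neg 1 * neg 1 = neg 1]. *)
Lemma sugihara_prelinear x y : 1 <= (x ==> y) `|` (y ==> x).
Proof.
apply: le1_join; rewrite -(idS (neg (_ `|` _))).
apply: (@leT ((x * neg y) * (y * neg x))).
  by apply: mul_mono => //; apply: leT (neg_imp _ _); apply: neg_anti;
    [exact: le_joinl | exact: le_joinr].
have -> : (x * neg y) * (y * neg x) = (x * neg x) * (y * neg y).
  rewrite -!(mulA cS); congr (_ * _).
  by rewrite (mulC cS (neg y)) (mulC cS y) -!(mulA cS).
by rewrite -(idS (neg 1)); apply: mul_mono.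
Qed.

(** With [w] for [(x ==> 1) ==> u], the negation of the join lies below
[(w * neg x) * neg u] by idempotence. Since [neg x <= x ==> 1], the first factor
is at most [u], and [u * neg u <= neg 1]. *)
Lemma sugihara_reflection x u : 1 <= (((x ==> 1) ==> u) ==> x) `|` u.
Proof.
apply: le1_join; rewrite -(idS (neg (_ `|` _))); set w := _ ==> u.
apply: (@leT ((w * neg x) * neg u)).
  apply: mul_mono => //; last by apply: neg_anti; exact: le_joinr.
  by apply: leT (neg_imp _ _); apply: neg_anti; exact: le_joinl.
apply: leT (mul_neg u); apply: mul_mono => //.
apply: leT (imp_elim cS (x ==> 1) u); rewrite (mulC cS).
by apply: mul_mono => //; apply: (imp_intro cS); exact: leT (mul_neg x) _.
Qed.

End SugiharaMonoids.

Lemma psm_lawsP (A : algebra) : positive_sugihara_monoid A -> psm_laws A.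
Proof.
case=> cA [S [neg [h [sS hh inj_h]]]].
have h_le x y : h x <= h y -> x <= y.
  by rewrite /le -(hom_meet hh) => /inj_h.
split=> // [x|x y z|x y|x u].
- by apply: inj_h; rewrite (hom_mul hh) (sugihara_idempotent sS).
- apply: inj_h; rewrite !(hom_meet hh, hom_join hh).
  exact: (sugihara_distributive sS).
- apply: h_le; rewrite !(hom_join hh, hom_imp hh, hom_one hh).
  exact: (sugihara_prelinear sS).
- apply: h_le; rewrite !(hom_join hh, hom_imp hh, hom_one hh).
  exact: (sugihara_reflection sS).
Qed.

(** * Collapsing an interval of a chain *)

(** In a chain, an element [u < 1] generates the congruence whose only
nontrivial class is the interval from [u] to [u ==> 1]. Sending that interval to
[1] and fixing all other elements is an endomorphism: the quotient by the
congruence is a retract of the chain. *)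
Section Collapse.
Variables (C : algebra) (pC : psm_laws C).
Implicit Types x y z : C.
Hypothesis total : forall x y, x <= y \/ y <= x.
Variable u : C.
Hypothesis u_lt1 : ~ 1 <= u.

Let cC := psm_CRL pC.
Let leT := le_trans cC.
Let leR := le_refl cC.
Let v := u ==> 1.
Let inI x := u <= x /\ x <= v.

Definition collapse x := if `[< inI x >] then 1 else x.

Lemma collapse_in x : inI x -> collapse x = 1.
Proof. by move=> Ix; rewrite /collapse asboolT. Qed.

Lemma collapse_out x : ~ inI x -> collapse x = x.
Proof. by move=> Ix; rewrite /collapse asboolF. Qed.

Lemma le_total x y : ~ x <= y -> y <= x.
Proof. by case: (total x y). Qed.

(** The side on which [x * y] lies of [1] decides: if [x <= y] and [x * y <= 1]
then [x * y = x * (x * y) <= x], and dually if [1 <= x * y]. *)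
Lemma mul_conservative x y : x * y = x \/ x * y = y.
Proof.
wlog xy : x y / x <= y => [wlog_xy|].
  have [|/wlog_xy[]] := total x y; [exact: wlog_xy | |];
    by rewrite (mulC cC y); auto.
have x_xy : x <= x * y.
  by rewrite -{1}(psm_idempotent pC x); apply: (mul_mono cC).
have xy_y : x * y <= y.
  by rewrite -{2}(psm_idempotent pC y); apply: (mul_mono cC).
have [xy1|xy1] := total (x * y) 1.
  left; apply: (le_anti cC) => //.
  have -> : x * y = x * (x * y) by rewrite (mulA cC) (psm_idempotent pC).
  by rewrite -{3}(mulr1 cC x); apply: (mul_mono cC).
right; apply: (le_anti cC) => //.
have -> : x * y = (x * y) * y by rewrite -(mulA cC) (psm_idempotent pC).
by rewrite -{1}(mul1 cC y); apply: (mul_mono cC).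
Qed.

Let u1 : u <= 1. Proof. exact: le_total. Qed.

Let one_v : 1 <= v. Proof. by apply: (imp_intro cC); rewrite (mulr1 cC). Qed.

Let inI1 : inI 1. Proof. by []. Qed.

Let inIu : inI u. Proof. by split=> //; exact: leT one_v. Qed.

Lemma collapse_bottom : collapse u = 1.
Proof. exact: collapse_in. Qed.

Let inIv : inI v. Proof. by split=> //; exact: leT one_v. Qed.

Let uv1 : u * v <= 1. Proof. exact: (imp_elim cC). Qed.

(* If [u * v] is [v] rather than [u], then [v <= 1], so [u * v <= u] anyway. *)
Let uvu : u * v <= u.
Proof.
have [->//|uv] := mul_conservative u v.
by rewrite -{2}(mulr1 cC u); apply: (mul_mono cC) => //; rewrite -uv.
Qed.

(** An element outside the interval is farther from [1] than any element inside,
and a product takes the value of the farther factor. *)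
Let mul_in_out x y : inI x -> ~ inI y -> x * y = y.
Proof.
move=> [ux xv] yI; have [uy|/le_total yu] := lem (u <= y).
  have yv : ~ y <= v by move=> yv; apply: yI.
  have uy1 : 1 <= u * y.
    by apply: le_total => /(imp_intro cC).
  have xyE : 1 <= x * y by apply: leT uy1 _; apply: (mul_mono cC).
  have [xy|//] := mul_conservative x y; case: yv; apply: leT xv.
  rewrite -xy -{1}(mul1 cC y); apply: (mul_mono cC) => //.
  by rewrite -xy.
have xy1 : x * y <= 1.
  by apply: leT uv1; rewrite (mulC cC u); apply: (mul_mono cC).
have [xy|//] := mul_conservative x y; case: yI; split.
  apply: leT ux _; rewrite -xy -{2}(mul1 cC y); apply: (mul_mono cC) => //.
  by rewrite -xy.
by apply: leT yu _; apply: leT one_v.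
Qed.

Let mul_out x y : ~ inI x -> ~ inI (x * y).
Proof.
move=> xI; have [yI|yI] := lem (inI y).
  by rewrite (mulC cC) mul_in_out.
by have [->|->] := mul_conservative x y.
Qed.

Let imp_in x y : inI x -> inI y -> inI (x ==> y).
Proof.
move=> xI [uy yv].
have u_imp : u <= x ==> y.
  apply: (imp_intro cC); apply: leT uy; apply: leT uvu.
  by rewrite (mulC cC); apply: (mul_mono cC) => //; case: xI.
apply: contrapT => zI; apply: (zI); split=> //.
by rewrite -(mul_in_out xI zI); apply: leT yv; exact: (imp_elim cC).
Qed.

Let imp_in_out x y : inI x -> ~ inI y -> x ==> y = y.
Proof.
move=> xI yI; apply: (le_anti cC); last first.
  by apply: (imp_intro cC); rewrite mul_in_out.
have xz := imp_elim cC x y.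
have [[uz zv]|zI] := lem (inI (x ==> y)); last first.
  by rewrite mul_in_out in xz.
apply: leT zv _; apply: le_total => yv; apply: yI; split=> //.
apply: leT xz; rewrite -(psm_idempotent pC u).
by apply: (mul_mono cC) => //; case: xI.
Qed.

Let imp_out_in x y : ~ inI x -> inI y -> x ==> y = x ==> 1.
Proof.
have imp_le y' y'' : ~ inI x -> inI y' -> inI y'' -> x ==> y' <= x ==> y''.
  move=> xI [uy' y'v] [uy'' y''v]; apply: (imp_intro cC).
  have xz := imp_elim cC x y'; apply: leT uy''; apply: le_total => uxz.
  by apply: (mul_out (y := x ==> y') xI); split=> //; exact: leT y'v.
by move=> xI yI; apply: (le_anti cC); apply: imp_le.
Qed.

(** The only place where more than an idempotent chain is needed. If
[x ==> y] were in the interval, then [x] would be below [u], and [x ==> 1] would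
not exceed [v = u ==> 1]. Then [u <= (x ==> 1) ==> u], and the reflection law
puts [u] below [x]. *)
Let imp_out x y : ~ inI x -> ~ inI y \/ y = 1 -> ~ inI (x ==> y).
Proof.
move=> xI yI zI; have xz := imp_elim cC x y.
rewrite (mulC cC) (mul_in_out zI xI) in xz.
have yv : y <= v.
  case: yI => [yI | -> //]; apply: leT (proj2 zI); apply: (imp_intro cC).
  by have [->|->] := mul_conservative x y.
have ux : ~ u <= x by move=> ux; apply: xI; split=> //; exact: leT yv.
have xv : x ==> 1 <= v.
  have [xx|xx] := mul_conservative x (x ==> 1); last first.
    by apply: leT one_v; rewrite -xx; exact: (imp_elim cC).
  by apply: leT (proj2 zI); apply: (imp_intro cC); rewrite xx.
have u_imp : u <= (x ==> 1) ==> u.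
  apply: (imp_intro cC); apply: leT uvu; rewrite (mulC cC).
  exact: (mul_mono cC).
have := psm_reflection pC x u; set w := _ ==> x => wu.
have [uw|wu'] := total u w; last by apply: u_lt1; rewrite -(joinE cC wu').
have w1 : 1 <= w by rewrite -(joinE cC uw) (joinC (CRL_lattice cC)).
by apply: ux; apply: leT u_imp _; apply/(le_imp1 cC).
Qed.

Let collapse_le x y : x <= y -> collapse x <= collapse y.
Proof.
move=> xy; have [xI|xI] := lem (inI x); have [yI|yI] := lem (inI y).
- by rewrite !collapse_in.
- rewrite collapse_in // collapse_out //; apply: leT one_v _.
  by apply: le_total => yv; apply: yI; split=> //; apply: leT xy; case: xI.
- rewrite collapse_out // collapse_in //; apply: leT u1.
  by apply: le_total => ux; apply: xI; split=> //; apply: leT xy _; case: yI.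
- by rewrite !collapse_out.
Qed.

Lemma collapse_hom : is_hom collapse.
Proof.
have lC := CRL_lattice cC.
split=> [x y|x y|x y|x y|]; last by rewrite collapse_in.
- have [xI|xI] := lem (inI x); have [yI|yI] := lem (inI y).
  + rewrite !collapse_in ?(mul1 cC) //.
    by rewrite /inI -(psm_idempotent pC u) -(psm_idempotent pC v);
      case: xI yI => ? ? [? ?]; split; apply: (mul_mono cC).
  + by rewrite mul_in_out // (collapse_in xI) (mul1 cC).
  + by rewrite (mulC cC) mul_in_out // (collapse_in yI) (mulr1 cC).
  + by rewrite !collapse_out //; exact: mul_out.
- have [xI|xI] := lem (inI x); have [yI|yI] := lem (inI y).
  + by rewrite !collapse_in ?(imp1l cC) //; exact: imp_in.
  + by rewrite imp_in_out // (collapse_in xI) (imp1l cC).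
  + rewrite imp_out_in // (collapse_out xI) (collapse_in yI).
    by rewrite collapse_out //; apply: imp_out; auto.
  + by rewrite !collapse_out //; apply: imp_out; auto.
- wlog xy : x y / x <= y => [wlog_xy|]; last by rewrite xy collapse_le.
  have [|yx] := total x y; first exact: wlog_xy.
  by rewrite (meetC lC) wlog_xy // (meetC lC).
- wlog xy : x y / x <= y => [wlog_xy|].
    have [|yx] := total x y; first exact: wlog_xy.
    by rewrite (joinC lC) wlog_xy // (joinC lC).
  by rewrite !(joinE cC) //; exact: collapse_le.
Qed.

(** When [u] is the largest element below [1], a subalgebra that meets the
collapsed interval outside [1] contains [u]: an element of the interval is [u]
itself if it is below [1], and has negation [u] if it is above. *)
Lemma collapse_id (A : algebra) (k : A -> C) :
  (forall x, ~ 1 <= x -> x <= u) -> is_hom k -> (forall a, k a <> u) ->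
  forall a, collapse (k a) = k a.
Proof.
move=> u_max hk ku a; have [[ua av]|] := lem (inI (k a));
  last exact: collapse_out.
have le_u x : ~ 1 <= x -> u <= x -> x = u.
  by move=> /u_max xu ux; apply: (le_anti cC).
have [a1|a1] := lem (1 <= k a); last by case: (ku a); exact: le_u.
rewrite collapse_in //; apply: (le_anti cC) => //.
apply: contrapT => na1; apply: (ku (imp a 1)).
rewrite (hom_imp hk) (hom_one hk); apply: le_u.
  by move=> /(le_imp1 cC).
by apply: (imp_intro cC); apply/(residuation cC).
Qed.

End Collapse.

(** * Filters *)

(** Requiring [1] makes these the deductive filters: by idempotence closure
under [meet] entails closure under [mul]. *)
Record is_filter (A : algebra) (F : A -> Prop) : Prop := IsFilter {
  filter_one : F 1;
  filter_up : forall x y, x <= y -> F x -> F y;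
  filter_meet : forall x y, F x -> F y -> F (x `&` y)
}.

Definition is_prime (A : algebra) (F : A -> Prop) : Prop :=
  forall x y, F (x `|` y) -> F x \/ F y.

Section Filters.
Variables (B : algebra) (pB : psm_laws B).
Implicit Types (x y z : B) (F G : B -> Prop).

Let cB := psm_CRL pB.
Let leT := le_trans cB.
Let leR := le_refl cB.

Lemma le_mul w x y : w <= x -> w <= y -> w <= x * y.
Proof.
by move=> wx wy; rewrite -(psm_idempotent pB w); apply: (mul_mono cB).
Qed.

Lemma filter_mp F x y : is_filter F -> F x -> F (x ==> y) -> F y.
Proof.
move=> fF Fx Fxy; apply: (filter_up fF) (filter_meet fF Fx Fxy).
apply: leT (imp_elim cB x y).
by apply: le_mul; [exact: meet_lel | exact: meet_ler].
Qed.

Lemma filter_le F x y : is_filter F -> x <= y -> F (x ==> y).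
Proof. by move=> fF /(le_imp1 cB) xy; apply: filter_up xy (filter_one fF). Qed.

Lemma filter_imp F w x y : is_filter F -> F w -> x * w <= y -> F (x ==> y).
Proof. by move=> fF Fw xwy; apply: filter_up Fw => //; exact: imp_intro. Qed.

Lemma filter_imp_trans F y x z :
  is_filter F -> F (x ==> y) -> F (y ==> z) -> F (x ==> z).
Proof.
move=> fF Fxy Fyz; apply: filter_imp (filter_meet fF Fxy Fyz) _ => //.
apply: leT (imp_elim cB y z).
apply: (@leT (x * ((x ==> y) * (y ==> z)))).
  apply: (mul_mono cB) => //.
  by apply: le_mul; [exact: meet_lel | exact: meet_ler].
rewrite (mulA cB); apply: (mul_mono cB) => //; exact: imp_elim.
Qed.

Lemma filter_imp_total F x y :
  is_filter F -> is_prime F -> F (x ==> y) \/ F (y ==> x).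
Proof.
move=> fF prF; apply: prF.
exact: filter_up (psm_prelinear pB x y) (filter_one fF).
Qed.

Definition filter_equiv F x y := F (x ==> y) /\ F (y ==> x).

Lemma filter_equiv_congruence F : is_filter F -> is_congruence (filter_equiv F).
Proof.
move=> fF.
have le_cong op : (forall x x' y y', F (x' ==> x) -> F (x ==> x') ->
      F (y ==> y') -> F (op x y ==> op x' y')) ->
    forall x x' y y', filter_equiv F x x' -> filter_equiv F y y' ->
      filter_equiv F (op x y) (op x' y').
  by move=> opP x x' y y' [? ?] [? ?]; split; apply: opP.
split=> [x|x y [] //|y x z [xy yx] [yz zy]|||| ].
- by split; apply: filter_le.
- by split; apply: (filter_imp_trans (y := y)).
- apply: le_cong => x x' y y' _ Fx Fy.
  apply: filter_imp (filter_meet fF Fx Fy) _ => //.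
  set w := _ `&` _.
  have -> : x * y * w = (x * w) * (y * w).
    rewrite -!(mulA cB); congr (_ * _).
    by rewrite (mulA cB w) (mulC cB w) -(mulA cB) (psm_idempotent pB).
  by apply: (mul_mono cB); [exact: mul_impl | exact: mul_impr].
- apply: le_cong => x x' y y' Fx _ Fy.
  apply: filter_imp_trans (_ : F ((x ==> y) ==> (x' ==> y))) _ => //.
    apply: filter_imp Fx _ => //; apply: (imp_intro cB).
    rewrite (mulC cB (x ==> y)) (mulA cB); apply: leT (imp_elim cB x y).
    by apply: (mul_mono cB) => //; exact: imp_elim.
  apply: filter_imp Fy _ => //; apply: (imp_intro cB).
  rewrite (mulA cB); apply: leT (imp_elim cB y y').
  by apply: (mul_mono cB) => //; exact: imp_elim.
- apply: le_cong => x x' y y' _ Fx Fy.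
  apply: filter_imp (filter_meet fF Fx Fy) _ => //; apply: (le_meet cB).
    apply: leT (mul_impl cB x x' (y ==> y')); apply: (mul_mono cB) => //.
    exact: meet_lel.
  apply: leT (mul_impr cB y y' (x ==> x')); apply: (mul_mono cB) => //.
  exact: meet_ler.
- apply: le_cong => x x' y y' _ Fx Fy.
  apply: filter_imp (filter_meet fF Fx Fy) _ => //; rewrite (mul_joinl cB).
  apply: (join_le cB).
    by apply: leT (le_joinl cB x' y'); exact: mul_impl.
  by apply: leT (le_joinr cB x' y'); exact: mul_impr.
Qed.

Lemma filter_quotient F : is_filter F ->
  exists (Q : algebra) (pi : B -> Q),
    [/\ is_hom pi, forall q, exists x, pi x = q,
        forall x y, pi x = pi y <-> filter_equiv F x y
      & forall x y, pi x <= pi y <-> F (x ==> y)].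
Proof.
move=> fF; have cong := filter_equiv_congruence fF.
have [Q [pi [hpi surj_pi piE]]] := quotient_algebra cong.
exists Q, pi; split=> // x y; rewrite /le -(hom_meet hpi).
split=> [/piE[_ Fx]|Fx].
  by apply: (filter_imp_trans (y := x `&` y)) => //; apply: filter_le => //;
    exact: meet_ler.
apply/piE; split; first by apply: filter_le => //; exact: meet_lel.
apply: filter_imp (filter_meet fF Fx (filter_one fF)) _ => //.
by apply: (le_meet cB); [exact: mul_meet1 | exact: mul_impl].
Qed.

Lemma prime_filter_exists F0 (I : B -> Prop) :
  is_filter F0 -> (forall x y, x <= y -> I y -> I x) ->
  (forall x y, I x -> I y -> I (x `|` y)) -> (forall x, F0 x -> ~ I x) ->
  exists F, [/\ is_filter F, is_prime F, forall x, F0 x -> F x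
    & forall x, F x -> ~ I x].
Proof.
move=> fF0 I_down I_join F0I.
pose good (F : set B) := [/\ is_filter F, forall x, F0 x -> F x
  & forall x, F x -> ~ I x].
have good0 : good F0 by split.
(* The empty set is admitted because [P] must hold of the union of the empty
   chain. *)
pose P (F : set B) := F = set0 \/ good F.
have [|M [PM maxM]] := @Zorn_bigcup B P.
  move=> S SP totS.
  have [[F [SF gF]]|noF] := lem (exists F, S F /\ good F); last first.
    left; apply/seteqP; split=> // x [F SF Fx].
    have [F_eq|gF] := SP _ SF; first by rewrite F_eq in Fx.
    by case: noF; exists F.
  have good_of G x : S G -> G x -> good G.
    by move=> SG Gx; have [G_eq|//] := SP _ SG; rewrite G_eq in Gx.
  right; split.
  - split.
    + by exists F => //; case: gF => /filter_one.
    + move=> x y xy [G SG Gx]; exists G => //.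
      by case: (good_of _ _ SG Gx) => fG _ _; exact: filter_up Gx.
    + move=> x y [G SG Gx] [H SH Hy].
      have [GH|HG] := totS _ _ SG SH.
        exists H => //; case: (good_of _ _ SH Hy) => fH _ _.
        by apply: filter_meet => //; exact: GH.
      exists G => //; case: (good_of _ _ SG Gx) => fG _ _.
      by apply: filter_meet => //; exact: HG.
  - by move=> x F0x; exists F => //; case: gF => _ sF _; exact: sF.
  - by move=> x [G SG Gx]; case: (good_of _ _ SG Gx) => _ _; exact.
have gM : good M.
  case: PM => // M0; case: (maxM F0); last by right.
  split; first by rewrite M0.
  by rewrite M0 => F00; have := F00 _ (filter_one fF0).
have [fM F0M MI] := gM; exists M; split=> //.
(* By maximality, adjoining [x] to [M] produces an element of [I]. *)
have meets_I x : ~ M x -> exists m, M m /\ I (m `&` x).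
  move=> Mx; apply: contrapT => noI.
  case: (maxM (fun z => exists m, M m /\ m `&` x <= z)).
    split=> [z Mz|sub]; first by exists z; split=> //; exact: meet_lel.
    apply: Mx; apply: sub; exists 1.
    by split; [exact: filter_one | exact: meet_ler].
  right; split.
  - split.
    + by exists 1; split; [exact: filter_one | exact: meet_lel].
    + by move=> y z yz [m [Mm my]]; exists m; split=> //; exact: leT my yz.
    + move=> y z [m [Mm my]] [n [Mn nz]]; exists (m `&` n).
      split; first exact: filter_meet.
      have lel := meet_lel cB; have ler := meet_ler cB.
      apply: (le_meet cB); [apply: leT my | apply: leT nz];
        apply: (le_meet cB) => //; by apply: leT (lel _ _) _.
  - by move=> y /F0M My; exists y; split=> //; exact: meet_lel.
  - by move=> y [m [Mm my]] Iy; apply: noI; exists m;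
      split=> //; exact: I_down Iy.
move=> x y Mxy; apply: contrapT => /not_orP[/meets_I[m [Mm Im]]].
move=> /meets_I[n [Mn In]].
apply: (MI ((m `&` n) `&` (x `|` y))).
  by apply: filter_meet => //; exact: filter_meet.
have meet_mono (a b c : B) : a <= b -> a `&` c <= b `&` c.
  move=> ab; apply: (le_meet cB); last exact: meet_ler.
  by apply: leT ab; exact: meet_lel.
rewrite (psm_distributive pB); apply: I_join.
  by apply: I_down Im; apply: meet_mono; exact: meet_lel.
by apply: I_down In; apply: meet_mono; exact: meet_ler.
Qed.

(** In the chain [B] modulo [F], where [b] lies strictly below [1], this is the
set of the elements strictly above [b]. Modulo this filter [b] becomes the
largest element strictly below [1]. *)
Lemma not_imp_prime_filter F b : is_filter F -> is_prime F -> ~ F b ->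
  is_filter (fun x => ~ F (x ==> b)) /\ is_prime (fun x => ~ F (x ==> b)).
Proof.
move=> fF prF Fb; split; first split.
- by rewrite (imp1l cB).
- move=> x y xy Fx Fy; apply: Fx; apply: filter_imp_trans Fy => //.
  exact: filter_le.
- move=> x y Fx Fy Fxy.
  have [Fi|Fi] := filter_imp_total x y fF prF; [apply: Fx | apply: Fy];
    apply: filter_imp_trans Fxy => //;
    apply: filter_imp (filter_meet fF Fi (filter_one fF)) _ => //;
    apply: (le_meet cB).
  + exact: mul_meet1.
  + exact: mul_impl.
  + exact: mul_impl.
  + exact: mul_meet1.
- move=> x y Fxy; apply: contrapT => /not_orP[/contrapT Fx /contrapT Fy].
  apply: Fxy; apply: filter_imp (filter_meet fF Fx Fy) _ => //.
  by rewrite (mul_joinl cB); apply: (join_le cB);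
    [exact: mul_impl | exact: mul_impr].
Qed.

End Filters.

(** * Epimorphisms *)

Section Epimorphisms.
Variables (K : algebra -> Prop) (varK : is_variety K).
Hypothesis psmK : forall A, K A -> positive_sugihara_monoid A.
Variables (A B : algebra) (h : A -> B).
Hypotheses (KB : K B) (hh : is_hom h) (epi_h : is_epimorphism K h).
Implicit Types (a : A) (b c : B) (F G : B -> Prop).

Let pB := psm_lawsP (psmK KB).
Let cB := psm_CRL pB.
Let leT := le_trans cB.
Let leR := le_refl cB.

(** Pass to the quotient [C] in which the missed element [b] is the largest
element below [1], and collapse there what [b] generates. The quotient map and
its composite with the collapse differ at [b] and agree on the image of [h],
unless that image reaches [b] modulo the larger filter. But [b] is then already
reached modulo [F]: by idempotence [b ==> (b ==> h a)] is [b ==> h a]. *)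
Lemma onto_prime_quotient_neg F b : is_filter F -> is_prime F -> ~ F b ->
  exists a, filter_equiv F (h a) b.
Proof.
move=> fF prF Fb; apply: contrapT => no_a.
have [fF1 prF1] := not_imp_prime_filter pB fF prF Fb.
have [C [pi [hpi surj_pi piE pi_le]]] := filter_quotient pB fF1.
have KC : K C by exact: variety_quotient KB hpi surj_pi.
have pC := psm_lawsP (psmK KC).
have total (x y : C) : x <= y \/ y <= x.
  have [x' <-] := surj_pi x; have [y' <-] := surj_pi y.
  by rewrite !pi_le; exact: (filter_imp_total pB x' y' fF1 prF1).
have pi_le1 x : 1 <= pi x <-> ~ F (x ==> b).
  by rewrite -(hom_one hpi) pi_le (imp1l cB).
have u_lt1 : ~ 1 <= pi b by rewrite pi_le1; apply; exact: filter_le.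
have u_max (x : C) : ~ 1 <= x -> x <= pi b.
  have [x' <-] := surj_pi x; rewrite pi_le1 pi_le => /contrapT Fx' Fx'b.
  by apply: Fb; exact: (filter_mp pB fF Fx' Fx'b).
have h_u a : pi (h a) <> pi b.
  move=> /piE[ab ba]; apply: no_a; exists a; split.
    apply: contrapT => Fab; have := filter_mp pB fF1 Fab ab; apply.
    exact: filter_le.
  have [//|Fi] := filter_imp_total pB (b ==> h a) b fF prF.
  apply: filter_up Fi => //; apply: (imp_intro cB).
  rewrite -{1}(psm_idempotent pB b) -(mulA cB).
  apply: leT (imp_elim cB b (h a)); apply: (mul_mono cB) => //.
  exact: imp_elim.
have hg := collapse_hom pC total u_lt1.
have collapse_b : pi b = collapse (pi b) (pi b).
  apply: (epi_h KC hpi (hom_comp hpi hg)) => a /=.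
  by rewrite (collapse_id pC u_max (hom_comp hh hpi) h_u).
apply: (u_lt1); rewrite collapse_b (collapse_bottom pC total u_lt1).
exact: le_refl (psm_CRL pC) 1.
Qed.

(** A [b] above [1] is replaced by its negation [b ==> 1]: if this is not below
[1] then [b] is equivalent to [1], and otherwise [b] is equivalent to its double
negation. *)
Lemma onto_prime_quotient F b : is_filter F -> is_prime F ->
  exists a, filter_equiv F (h a) b.
Proof.
move=> fF prF; have [Fb|] := lem (F b); last exact: onto_prime_quotient_neg.
have cong := filter_equiv_congruence pB fF.
have [Fb1|Fb1] := lem (F (b ==> 1)).
  exists 1; rewrite (hom_one hh); split=> //.
  by rewrite (imp1l cB).
have [a ab] := onto_prime_quotient_neg fF prF Fb1.
exists (a ==> 1); rewrite (hom_imp hh) (hom_one hh).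
apply: (cong_trans cong (y := (b ==> 1) ==> 1)).
  by apply: (cong_imp cong) => //; exact: cong_refl.
split; last first.
  by apply: filter_le => //; apply: (imp_intro cB); rewrite (mulC cB);
    exact: imp_elim.
(* With [c := b ==> 1] for [u], the first disjunct [(c ==> c) ==> b] of the
   reflection law holds modulo [F]. Here [c ==> c] may be replaced by the smaller
   [c ==> 1], since [c * (c ==> 1) = c * (c * (c ==> 1)) <= c * 1]. *)
have Fr := filter_up fF (psm_reflection pB b (b ==> 1)) (filter_one fF).
have [Fi|//] := prF _ _ Fr; move: Fi.
apply: filter_imp_trans => //; apply: filter_le => //; apply: (imp_intro cB).
set c := b ==> 1.
rewrite -(psm_idempotent pB c) -(mulA cB) -[X in _ <= X](mulr1 cB).
by rewrite (psm_idempotent pB c); apply: (mul_mono cB) => //; exact: imp_elim.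
Qed.

(** Let [F'] be the filter generated by [F] and the trace of [G]. Its trace is
that of [G], so choosing a preimage modulo [G] under [h] gives a well-defined
homomorphism [g] from [B] to its quotient by [F']. It agrees with the quotient
map on the image of [h], so everywhere. *)
Lemma prime_filter_trace_le F G :
  is_filter F -> is_filter G -> is_prime G ->
  (forall a, F (h a) -> G (h a)) -> forall b, F b -> G b.
Proof.
move=> fF fG prG FG.
pose F' x := exists a, G (h a) /\ F (h a ==> x).
have F'h a : F' (h a) -> G (h a).
  move=> [a' [Ga' Fi]]; apply: (filter_mp pB fG Ga').
  by rewrite -(hom_imp hh); apply: FG; rewrite (hom_imp hh).
have hF' a : G (h a) -> F' (h a).
  by move=> Ga; exists a; split=> //; exact: filter_le.
have FF' x : F x -> F' x.
  move=> Fx; exists 1; rewrite (hom_one hh) (imp1l cB).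
  by split=> //; exact: filter_one.
have fF' : is_filter F'.
  split.
  - by apply: FF'; exact: filter_one.
  - move=> x y xy [a [Ga Fi]]; exists a; split=> //.
    by apply: filter_imp_trans Fi _ => //; exact: filter_le.
  - move=> x y [a [Ga Fa]] [a' [Ga' Fa']]; exists (a `&` a').
    rewrite (hom_meet hh); split; first exact: filter_meet.
    apply: filter_imp (filter_meet fF Fa Fa') _ => //; apply: (le_meet cB).
      apply: leT (mul_impl cB (h a) x _); apply: (mul_mono cB) => //.
      exact: meet_lel.
    apply: leT (mul_impr cB (h a') y _); apply: (mul_mono cB) => //.
    exact: meet_ler.
have [C [pi [hpi surj_pi piE _]]] := filter_quotient pB fF'.
have KC : K C by exact: variety_quotient KB hpi surj_pi.
have congG := filter_equiv_congruence pB fG.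
have [s sG] := choice (fun b => onto_prime_quotient b fG prG).
have pi_h a a' : filter_equiv G (h a) (h a') -> pi (h a) = pi (h a').
  by case=> Gi Gi'; apply/piE; split; rewrite -(hom_imp hh); apply: hF';
    rewrite (hom_imp hh).
pose g b := pi (h (s b)).
have trans := cong_trans congG; have sym := cong_sym congG.
have hg : is_hom g.
  split=> [x y|x y|x y|x y|]; rewrite /g.
  - rewrite -(hom_mul hpi) -(hom_mul hh); apply: pi_h.
    by apply: trans (sG _) _; rewrite (hom_mul hh); apply/sym/(cong_mul congG).
  - rewrite -(hom_imp hpi) -(hom_imp hh); apply: pi_h.
    by apply: trans (sG _) _; rewrite (hom_imp hh); apply/sym/(cong_imp congG).
  - rewrite -(hom_meet hpi) -(hom_meet hh); apply: pi_h.
    by apply: trans (sG _) _; rewrite (hom_meet hh); apply/sym/(cong_meet congG).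
  - rewrite -(hom_join hpi) -(hom_join hh); apply: pi_h.
    by apply: trans (sG _) _; rewrite (hom_join hh); apply/sym/(cong_join congG).
  - by rewrite -(hom_one hpi) -(hom_one hh); apply: pi_h; rewrite (hom_one hh).
have pi_g : forall b, pi b = g b.
  by apply: (epi_h KC hpi hg) => a; apply: pi_h; exact/sym.
move=> b /FF' F'b; have /piE[F'i _] := pi_g b.
by apply: (filter_mp pB fG _ (proj1 (sG b))); apply: F'h; exact: filter_mp F'i.
Qed.

(** Compactness: the elements [c] of [J] are the negative elements of the image
that certify [b] to be in the image where [c] holds, and it suffices to show that
they generate the improper ideal. *)
Lemma epimorphism_surjective b : exists a, h a = b.
Proof.
pose J c := c <= 1 /\ (exists a, h a = c) /\ (exists a, h a = c * b).
pose I x := exists c, J c /\ x <= c.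
have [[c [[c1 [_ [a ha]]] c1']]|I1] := lem (I 1).
  by exists a; rewrite ha (le_anti cB c1 c1') (mul1 cB).
have [|||x /= x1 Ix|F [fF prF _ FI]] :=
    prime_filter_exists pB (F0 := fun x => 1 <= x) (I := I).
- split=> //; first by move=> x y xy x1; exact: leT xy.
  by move=> x y; exact: le_meet.
- by move=> x y xy [c [Jc yc]]; exists c; split=> //; exact: leT yc.
- move=> x y [c [[c1 [[a ha] [a' ha']]] xc]] [d [[d1 [[k hk] [k' hk']]] yd]].
  exists (c `|` d); split; last first.
    by apply: (join_le cB); [apply: leT xc _; exact: le_joinl
                            | apply: leT yd _; exact: le_joinr].
  split; first exact: join_le.
  split; first by exists (a `|` k); rewrite (hom_join hh) ha hk.
  by exists (a' `|` k'); rewrite (hom_join hh) ha' hk' (mul_joinl cB).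
- by apply: I1; case: Ix => c [Jc xc]; exists c; split=> //; exact: leT xc.
have [a [Fab Fba]] := onto_prime_quotient b fF prF.
(* Multiplication by an element below [w] sends [b] and [h a] to the same
   element. *)
pose w := (h a ==> b) `&` (b ==> h a) `&` 1.
have Fw : F w by apply: filter_meet (filter_one fF) => //; exact: filter_meet.
have [[k [Fk kw]]|noP] := lem (exists k, F (h k) /\ h k <= w).
  case: (FI _ Fk); exists (h k); split=> //; split.
    by apply: leT kw _; exact: meet_ler.
  split; first by exists k.
  exists (k * a); rewrite (hom_mul hh).
  have mul_le x y : h k <= x ==> y -> h k * x <= h k * y.
    move=> kxy; rewrite -{1}(psm_idempotent pB (h k)) -(mulA cB).
    by apply: (mul_mono cB) => //; apply/(residuation cB).
  apply: (le_anti cB); apply: mul_le; apply: leT kw _;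
    apply: leT (meet_lel cB _ _) _; [exact: meet_lel | exact: meet_ler].
have [||||G [fG prG PG Gw]] :=
    prime_filter_exists pB (F0 := fun x => exists k, F (h k) /\ h k <= x)
      (I := fun x => x <= w).
- split.
  + by exists 1; rewrite (hom_one hh); split=> //; exact: filter_one.
  + by move=> x y xy [k [Fk kx]]; exists k; split=> //; exact: leT xy.
  + move=> x y [k [Fk kx]] [k' [Fk' ky]]; exists (k `&` k').
    rewrite (hom_meet hh); split; first exact: filter_meet.
    apply: (le_meet cB); [apply: leT kx | apply: leT ky];
      [exact: meet_lel | exact: meet_ler].
- by move=> x y xy yw; exact: leT yw.
- by move=> x y; exact: join_le.
- by move=> x [k [Fk kx]] xw; apply: noP; exists k; split=> //; exact: leT xw.
case: (Gw w) => //; apply: prime_filter_trace_le Fw => // k Fk.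
by apply: PG; exists k.
Qed.

End Epimorphisms.

(** * The infinite Beth property *)

Section Beth.
Variables (K : algebra -> Prop) (varK : is_variety K).
Hypothesis psmK : forall A, K A -> positive_sugihara_monoid A.

Let crlK A : K A -> is_CRL A. Proof. by case/psmK. Qed.

Lemma logic_axiom V (Gamma : set (term V)) alpha :
  Gamma alpha -> logic_of K Gamma alpha.
Proof.
move=> Ga; exists [set alpha]%classic; split.
- exact: finite_set1.
- by move=> _ ->.
- by move=> A v _; apply.
Qed.

Lemma logic_entail V (Gamma : set (term V)) alpha beta gamma :
  logic_of K Gamma alpha -> logic_of K Gamma beta ->
  (forall (A : algebra) (v : V -> A), K A ->
     le one (eval v alpha) -> le one (eval v beta) -> le one (eval v gamma)) ->
  logic_of K Gamma gamma.
Proof.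
move=> [Da [finDa DaG Kalpha]] [Db [finDb DbG Kbeta]] Kgamma.
exists (Da `|` Db)%classic; split.
- by rewrite finite_setU.
- by move=> x [/DaG|/DbG].
- move=> A v KA Dv; apply: Kgamma => //.
  + by apply: Kalpha => // x Dx; apply: Dv; left.
  + by apply: Kbeta => // x Dx; apply: Dv; right.
Qed.

Lemma logic_valid V (Gamma : set (term V)) gamma :
  (forall (A : algebra) (v : V -> A), K A -> le one (eval v gamma)) ->
  logic_of K Gamma gamma.
Proof.
move=> Kgamma; exists set0; split=> [||A v KA _]; last exact: Kgamma.
- exact: finite_set0.
- exact: sub0set.
Qed.

Lemma logic_sound V (Gamma : set (term V)) gamma (A : algebra) (v : V -> A) :
  logic_of K Gamma gamma -> K A ->
  (forall alpha, Gamma alpha -> le one (eval v alpha)) -> le one (eval v gamma).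
Proof. by move=> [D [_ DG KD]] KA Gv; apply: KD => // x /DG /Gv. Qed.

Lemma logic_equiv_congruence V (Gamma : set (term V)) :
  is_congruence
    (fun s t : term_algebra V => logic_of K Gamma (equiv_term s t)).
Proof.
have entail s t s' t' u w :
    logic_of K Gamma (equiv_term s t) -> logic_of K Gamma (equiv_term s' t') ->
    (forall (A : algebra) (v : V -> A), eval v s = eval v t ->
       eval v s' = eval v t' -> eval v u = eval v w) ->
    logic_of K Gamma (equiv_term u w).
  move=> G1 G2 st_uw; apply: logic_entail G1 G2 _ => A v KA.
  by move=> /(equiv_le1 (crlK KA)) st /(equiv_le1 (crlK KA)) st';
    apply/(equiv_le1 (crlK KA)); exact: st_uw.
split=> [s|s t Gst|t s r Gst Gtr|s s' t t' Gs Gt|s s' t t' Gs Gt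
        |s s' t t' Gs Gt|s s' t t' Gs Gt].
- by apply: logic_valid => A v KA; apply/(equiv_le1 (crlK KA)).
- by apply: (entail s t s t) => // A v ->.
- by apply: entail Gst Gtr _ => A v ->.
- by apply: entail Gs Gt _ => A v /= -> ->.
- by apply: entail Gs Gt _ => A v /= -> ->.
- by apply: entail Gs Gt _ => A v /= -> ->.
- by apply: entail Gs Gt _ => A v /= -> ->.
Qed.

Lemma variety_logic_quotient V (Gamma : set (term V)) (Q : algebra)
    (pi : term_algebra V -> Q) :
  is_hom pi -> (forall q, exists t, pi t = q) ->
  (forall s t, pi s = pi t <-> logic_of K Gamma (equiv_term s t)) -> K Q.
Proof.
move=> hpi surj_pi piE; case: (varK) => E KE; apply/KE => s t st v.
have [r rK] := choice (fun n => surj_pi (v n)).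
have -> : v = pi \o r by apply/funext => n /=; rewrite rK.
rewrite -!(hom_eval _ _ hpi) !eval_term_algebra; apply/piE.
apply: logic_valid => A w KA; apply/(equiv_le1 (crlK KA)).
by rewrite !eval_subst; move/KE: KA; exact.
Qed.

(** The homomorphism is the map from formulas over [X] to the algebra of
formulas over [X + Z] modulo equivalence under [Gamma]. *)
Lemma infinite_Beth : infinite_Beth_property (logic_of K).
Proof.
move=> X Z Gamma beth z.
have [B [pi [hpi surj_pi piE]]] :=
  quotient_algebra (logic_equiv_congruence Gamma).
have KB : K B := variety_logic_quotient hpi surj_pi piE.
pose h (t : term_algebra X) : B := pi (rename inl t).
have hh : is_hom h by split=> *; rewrite /h -?(hom_mul hpi) -?(hom_imp hpi)
  -?(hom_meet hpi) -?(hom_join hpi) -?(hom_one hpi).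
have pi_Gamma gamma : Gamma gamma -> 1 <= pi gamma.
  move=> Gg; rewrite /le -(hom_one hpi) -(hom_meet hpi); apply/piE.
  apply: logic_entail (logic_axiom Gg) (logic_axiom Gg) _ => A v KA g1 _.
  exact/(equiv_le1 (crlK KA)).
have epi_h : is_epimorphism K h.
  move=> C f g KC hf hg fg b; have [t <-] := surj_pi b.
  have fpi s : f (pi s) = eval (f \o pi \o @Var _) s.
    exact: hom_term_algebra (hom_comp hpi hf).
  have gpi s : g (pi s) = eval (g \o pi \o @Var _) s.
    exact: hom_term_algebra (hom_comp hpi hg).
  suff fg_var : f \o pi \o @Var _ = g \o pi \o @Var _ by rewrite fpi fg_var gpi.
  apply/funext => -[x | y]; first exact: fg (Var x).
  (* With the elements of [C] as further variables, [f] evaluates [Gamma] and,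
     at the same valuation, [g] evaluates its substitution instance. *)
  pose sigma (i : X + Z) : term (X + Z + C) :=
    match i with
    | inl x => Var (inl (inl x))
    | inr z => Var (inr (g (pi (Var (inr z)))))
    end.
  pose v (i : X + Z + C) : C :=
    match i with inl i => f (pi (Var i)) | inr c => c end.
  have Lz := beth _ sigma (fun=> erefl) y.
  apply/(equiv_le1 (crlK KC) v (Var (inl (inr y))) (sigma (inr y))).
  apply: logic_sound Lz KC _ => _ [] [gamma /pi_Gamma g1 <-].
    by rewrite eval_subst -(hom_one hf) -fpi; exact: hom_le hf g1.
  rewrite eval_subst; have := hom_le hg g1; rewrite (hom_one hg) gpi.
  congr (_ <= eval _ gamma); apply/funext => -[x|//].
  by rewrite /= (fg (Var x)).
have [t ht] := epimorphism_surjective varK psmK KB hh epi_h (pi (Var (inr z))).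
by exists t; apply/piE.
Qed.

End Beth.

Theorem theorem8p6 (K : algebra -> Prop) (hK : is_variety K)
    (hPSM : forall A : algebra, K A -> positive_sugihara_monoid A) :
  epimorphisms_surjective K /\ infinite_Beth_property (logic_of K).
Proof.
split; last exact: infinite_Beth hK hPSM.
move=> A B h _ KB hh epi_h; exact: (epimorphism_surjective hK hPSM KB hh epi_h).
Qed.
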